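(* Let $p$ be a prime, let $G$ be a finite abelian $p$-group, and let $\sigma$ be a skew-morphism of $G$ whose order $|\sigma|$ is coprime to $p$. Then $\sigma$ is a group automorphism of $G$.
   Context: A skew-morphism of a finite group $G$ is a permutation $\sigma$ of $G$ fixing the identity element for which there exists a function $\pi\colon G\to\mathbb{Z}$ with $\sigma(gh)=\sigma(g)\sigma^{\pi(g)}(h)$ for all $g,h\in G$. Its order $|\sigma|$ is its order as a permutation. *)

(* Defs.v *)
From mathcomp Require Import all_boot all_order all_algebra all_fingroup.
From mathcomp Require Import all_solvable.

Set Implicit Arguments.
Unset Strict Implicit.
Unset Printing Implicit Defensive.

Local Open Scope group_scope.

Definition zexpg (gT : finGroupType) (x : gT) (m : int) : gT :=
  match m with
  | Posz n => x ^+ n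
  | Negz n => x ^- n.+1
  end.

(* A permutation of the subgroup G is encoded, as for [Aut G], by a           *)
(* permutation of the ambient type that is the identity outside G; its order  *)
(* is then its order as a permutation of G. Only the values of pi on G count. *)
Definition skew_morphism (gT : finGroupType) (G : {group gT})
    (sigma : {perm gT}) : Prop :=
  [/\ perm_on G sigma,
      sigma 1 = 1
    & exists pi : gT -> int,
        {in G &, forall g h, sigma (g * h) = sigma g * zexpg sigma (pi g) h}].

(* Main.v *)
(* Inside Sym(G), let L be the group of translations by G and C = <sigma>. The
   skew-morphism identity gives LC = CL, so A = LC is a group in
   which L is an abelian p-group and C a cyclic Hall p'-subgroup. By Ito's
   argument K = [L, C] is abelian. Its p'-part is normal in A and lies in every
   Hall p'-subgroup of A, hence in C; but C has trivial core, since its elements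
   fix 1 and L is transitive on G. So K is a normal p-subgroup, K <= L, and
   sigma normalises L, which means that sigma is a homomorphism. *)
Require Import Defs.
From mathcomp Require Import all_boot all_order all_algebra all_fingroup.
From mathcomp Require Import all_solvable.

Set Implicit Arguments.
Unset Strict Implicit.
Unset Printing Implicit Defensive.

Local Open Scope group_scope.

Section Factorization.

Variables (gT : finGroupType) (L C : {group gT}).
Hypotheses (abL : abelian L) (abC : abelian C) (LC : commute (L : {set gT}) C).

Lemma commute_mulg_lr x y : x \in L -> y \in C ->
  exists2 y', y' \in C & exists2 x', x' \in L & x * y = y' * x'.
Proof.
move=> Lx Cy; have: x * y \in L * C by rewrite mem_mulg.
by rewrite LC => /mulsgP[y' x' Cy' Lx' ->]; exists y' => //; exists x'.
Qed.

Lemma commute_mulg_rl y x : y \in C -> x \in L ->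
  exists2 x', x' \in L & exists2 y', y' \in C & y * x = x' * y'.
Proof.
move=> Cy Lx; have: y * x \in C * L by rewrite mem_mulg.
by rewrite -LC => /mulsgP[x' y' Lx' Cy' ->]; exists x' => //; exists y'.
Qed.

(* Ito: if b ^ u lies in L c and a ^ v in C d, then both orders of conjugation
   by u and v send [~ a, b] to [~ d, c]. *)
Lemma abelian_commg_factorization : abelian [~: L, C].
Proof.
have conjC (a b u v : gT) : a \in L -> b \in C -> u \in L -> v \in C ->
  [~ a, b] ^ (u * v) = [~ a, b] ^ (v * u).
  move=> La Cb Lu Cv.
  have cL x y : x \in L -> y \in L -> [~ x, y] = 1.
    by move=> Lx Ly; apply/eqP/commgP/(centsP abL).
  have cC x y : x \in C -> y \in C -> [~ x, y] = 1.
    by move=> Cx Cy; apply/eqP/commgP/(centsP abC).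
  have [d0 Ld0 [c Cc def_bu]] := commute_mulg_rl Cb Lu.
  have {}def_bu : b ^ u = u^-1 * d0 * c by rewrite conjgE def_bu mulgA.
  have Le : u^-1 * d0 \in L by rewrite groupM ?groupV.
  have [c0 Cc0 [d Ld def_av]] := commute_mulg_lr La Cv.
  have {}def_av : a ^ v = v^-1 * c0 * d by rewrite conjgE def_av mulgA.
  have Cf : v^-1 * c0 \in C by rewrite groupM ?groupV.
  have fixL x : x \in L -> x ^ u = x by move=> Lx; apply/conjg_fixP/eqP/cL.
  have fixC y : y \in C -> y ^ v = y by move=> Cy; apply/conjg_fixP/eqP/cC.
  (* The factor of [b ^ u] in [L] commutes with [x] and drops out. Since [c] depends only on [b] and
     [u], the formula serves for both [x = a] and [x = d]. *)
  have Lbu x : x \in L -> [~ x, b] ^ u = [~ x, c].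
    by move=> Lx; rewrite conjRg (fixL x) // def_bu commgMJ
      (cL x (u^-1 * d0)) // conj1g mulg1.
  have Cav y : y \in C -> [~ a, y] ^ v = [~ d, y].
    by move=> Cy; rewrite conjRg (fixC y) // def_av commMgJ
      (cC (v^-1 * c0)) // conj1g mul1g.
  by rewrite !conjgM Lbu // !Cav // Lbu.
rewrite /commutator abelian_gen; apply/centsP => _ /imset2P[a b La Cb ->].
move=> _ /imset2P[u v Lu Cv ->]; apply/commgP/conjg_fixP.
(* By [conjC] at the inverses, [u^-1 * v^-1] may be swapped to [v^-1 * u^-1], which cancels
   [u * v]. *)
have ->: [~ u, v] = u^-1 * v^-1 * (u * v) by rewrite commgEl conjgE !mulgA.
by rewrite conjgM conjC ?groupV // -conjgM mulgA mulgKV mulVg conjg1.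
Qed.

Lemma coprime_factorization_norm (p : nat) :
  p.-group L -> p^'.-group C -> gcore C L :=: 1 -> C \subset 'N(L).
Proof.
move=> pL p'C coreC1; set K := [~: L, C].
have sLA: L \subset L <*> C := joing_subl L C.
have sCA: C \subset L <*> C := joing_subr L C.
have nKA: K <| L <*> C := commg_normal L C.
have coLC: coprime #|L| #|C| := pnat_coprime pL p'C.
have cardA: #|L <*> C| = (#|L| * #|C|)%N.
  by rewrite comm_joingE // coprime_cardMg.
have hallC: p^'.-Hall(L <*> C) C.
  by rewrite /pHall sCA p'C -divgS // cardA mulnK // pnatNK.
have hallL: p.-Hall(L <*> C) L.
  by rewrite /pHall sLA pL -divgS // cardA mulKn.
have nQA: 'O_p^'(K) <| L <*> C := char_normal_trans (pcore_char _ _) nKA.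
have Q1: 'O_p^'(K) = 1.
  apply/trivgP; rewrite -coreC1 gcore_max ?(subset_trans sLA) ?normal_norm //.
  apply: subset_trans (pcore_sub_Hall hallC).
  exact: pcore_max (pcore_pgroup _ _) nQA.
rewrite -commg_subl -/K.
have nilK: nilpotent K := abelian_nil abelian_commg_factorization.
(* A nilpotent [K] is ['O_p(K) \x 'O_p^'(K)], and the second factor is trivial. *)
rewrite -[K](dprodW (nilpotent_pcoreC p nilK)) Q1 mulg1.
apply: subset_trans (pcore_sub_Hall hallL).
apply: pcore_max (pcore_pgroup _ _) _.
exact: char_normal_trans (pcore_char _ _) nKA.
Qed.

End Factorization.

Section Translations.

Variables (gT : finGroupType) (G : {group gT}).

Lemma acts_rtranslation : [acts G, on G | 'R].
Proof. by rewrite astabsR. Qed.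

(** Restricting ['R] to [G] makes each translation the identity outside [G], the same convention as
    for [sigma], so that both lie in one permutation group. *)
Definition rtranslation : gT -> {perm gT} := actperm <[acts_rtranslation]>.

Canonical rtranslation_morphism := [morphism of rtranslation].

Lemma rtranslationE g x : g \in G ->
  rtranslation g x = if x \in G then x * g else x.
Proof. by move=> Gg; rewrite actpermE /= /actby Gg andbT. Qed.

End Translations.

Section SkewMorphism.

Variables (gT : finGroupType) (G : {group gT}) (sigma : {perm gT}).
Hypotheses (sG : perm_on G sigma) (s1 : sigma 1 = 1).

Let L := (rtranslation G @* G)%G.

Lemma gcore_cycle_rtranslation : gcore <[sigma]> L :=: 1.
Proof.
have sNC: gcore <[sigma]> L \subset <[sigma]> := gcore_sub _ _.
have fix1 n : n \in gcore <[sigma]> L -> n 1 = 1.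
  by case/(subsetP sNC)/cycleP=> i ->; rewrite permX iter_fix.
apply/trivgP/subsetP=> n Nn; rewrite inE; apply/eqP/permP=> x; rewrite perm1.
have [Gx | notGx] := boolP (x \in G); last first.
  have /cycleP[i ->] := subsetP sNC n Nn.
  by rewrite permX iter_fix // (out_perm sG).
(* The conjugate [n ^ t^-1] stays in the core, hence fixes 1; conjugating back, [n] fixes
   [t 1 = x]. *)
set t := rtranslation G x.
have t1: t 1 = x by rewrite /t rtranslationE // group1 mul1g.
have Nm: n ^ t^-1 \in gcore <[sigma]> L.
  have Lt: t^-1 \in L by rewrite groupV mem_morphim.
  by rewrite memJ_norm // (subsetP (gcore_norm _ _)).
by rewrite -{1}t1 -[n](conjgKV t) permJ fix1.
Qed.

Lemma skew_commute : abelian G -> skew_morphism G sigma ->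
  commute (L : {set {perm gT}}) <[sigma]>.
Proof.
move=> abG [_ _ [pi skew]].
have Gs y : y \in G -> sigma y \in G by rewrite (perm_closed _ sG).
have zC m : zexpg sigma m \in <[sigma]>.
  by case: m => n /=; rewrite ?groupV mem_cycle.
have Gz y m : y \in G -> zexpg sigma m y \in G.
  move=> Gy; have /cycleP[i ->] := zC m.
  by rewrite permX; elim: i => //= i; apply: Gs.
have zout y m : y \notin G -> zexpg sigma m y = y.
  have /cycleP[i -> Gy] := zC m.
  by rewrite permX iter_fix // (out_perm sG).
(* This is the skew-morphism identity as an equation of permutations, the left factor acting first.
   Commutativity of [G] turns its left multiplications into right translations. *)
have swap g : g \in G -> rtranslation G g * sigma =
    zexpg sigma (pi g) * rtranslation G (sigma g).
  move=> Gg; apply/permP=> x; rewrite !permM !rtranslationE ?Gs //.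
  have [Gx | notGx] := boolP (x \in G).
    rewrite Gz // (centsP abG x) // skew //.
    by apply: (centsP abG); rewrite ?Gs ?Gz.
  by rewrite zout // (negPf notGx) (out_perm sG).
have sLC: L * <[sigma]> \subset <[sigma]> * L.
  apply/subsetP=> _ /mulsgP[_ _ /morphimP[g _ Gg ->] /cycleP[i ->] ->].
  (* Each further factor [sigma] is moved left past the translation by [swap]. *)
  elim: i => [|i /mulsgP[c _ Cc /morphimP[h _ Gh ->] def_x]].
    by rewrite mulg1 -[X in X \in _]mul1g mem_mulg // mem_morphim.
  rewrite expgSr mulgA def_x -mulgA swap // mulgA mem_mulg ?groupM //.
  by rewrite mem_morphim ?Gs.
apply/eqP; rewrite eqEsubset sLC /=.
(* Inversion exchanges the two products, so one inclusion gives the other. *)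
by rewrite -invSg !invMg !invGid.
Qed.

(** Conjugation by [sigma] takes translation by [g] to translation by some [k], so
    [sigma (y * g) = sigma y * k] on [G]; [y = 1] forces [k = sigma g]. *)
Lemma norm_rtranslation_Aut : sigma \in 'N(L) -> sigma \in Aut G.
Proof.
move=> nL; rewrite inE sG; apply/morphicP=> x g Gx Gg.
have Gs y : y \in G -> sigma y \in G by rewrite (perm_closed _ sG).
have: rtranslation G g ^ sigma \in L by rewrite memJ_norm // mem_morphim.
case/morphimP=> k _ Gk def_k.
have sM y : y \in G -> sigma (y * g) = sigma y * k.
  move=> Gy; have := permJ (rtranslation G g) sigma y.
  by rewrite def_k !rtranslationE // Gs // Gy.
by rewrite sM // -[sigma g]mul1g -[in sigma g](mul1g g) sM ?s1 ?mul1g.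
Qed.

End SkewMorphism.

Theorem corollary6 (p : nat) (gT : finGroupType) (G : {group gT})
    (sigma : {perm gT}) (p_prime : prime p) (abelG : abelian G)
    (pG : (p.-group G)%g) (skew_sigma : skew_morphism G sigma)
    (co_sigma_p : coprime #[sigma]%g p) :
  sigma \in Aut G.
Proof.
have [sG s1 _] := skew_sigma.
apply: norm_rtranslation_Aut => //.
rewrite -cycle_subG; apply: (@coprime_factorization_norm _ _ _ _ _ _ p).
- exact: morphim_abelian.
- exact: cycle_abelian.
- exact: skew_commute.
- exact: morphim_pgroup.
- by rewrite /pgroup p'natE // -prime_coprime // coprime_sym.
- exact: gcore_cycle_rtranslation.
Qed.
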